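(* Let $\alpha$ be a non-zero algebraic number and let $x$ be a positive real number satisfying $$x\cdot\left(\log\bar M(\alpha)-\log C(\alpha)\right)\le\log 2.$$ Then $M_x(\alpha)=\bar M(\alpha)$.
   Context: $\overline{\mathbb Q}^\times$ is the multiplicative group of non-zero algebraic numbers and $\mathrm{Tor}(\overline{\mathbb Q}^\times)$ is its torsion subgroup, i.e. the group of roots of unity. For $f(z)=a\prod_{n=1}^N(z-\alpha_n)\in\mathbb C[z]$ with $a\neq 0$, the (logarithmic) Mahler measure is $M(f)=\log|a|+\sum_{n=1}^N\log^+|\alpha_n|$, where $\log^+ t=\max\{\log t,0\}$ (and $\log^+0=0$). For $\alpha\in\overline{\mathbb Q}^\times$, $M(\alpha)$ denotes the Mahler measure of the minimal polynomial of $\alpha$ over $\mathbb Z$ (primitive, irreducible, with integer coefficients). For real $x>0$, the $x$-metric Mahler measure is $$M_x(\alpha)=\inf\left\{\left(\sum_{n=1}^\infty M(\alpha_n)^x\right)^{1/x}\right\},$$ the infimum being over all sequences $(\alpha_1,\alpha_2,\ldots)$ in $\overline{\mathbb Q}^\times$ with $\alpha_n=1$ for all but finitely many $n$ and $\prod_{n=1}^\infty\alpha_n=\alpha$. The modified Mahler measure is $\bar M(\alpha)=\inf\{M(\zeta\alpha):\zeta\in\mathrm{Tor}(\overline{\mathbb Q}^\times)\}$. $K_\alpha$ denotes the Galois closure of $\mathbb Q(\alpha)$ over $\mathbb Q$, and $C(\alpha)=\inf\{M(\gamma):\gamma\in K_\alpha\setminus\mathrm{Tor}(\overline{\mathbb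 Q}^\times),\ \gamma\neq0\}$; this infimum is attained, so $C(\alpha)>0$. When $\alpha$ is a root of unity, $\bar M(\alpha)=0$ and $\log 0$ is read as $-\infty$ (so the displayed condition holds for every $x$). *)

(* Defs.v *)
(* Algebraic numbers are the elements of R[i] that are algebraic over rat, where
   R is any realType, so that R[i] is the field of complex numbers. *)
From HB Require Import structures.
From mathcomp Require Import all_boot all_order all_algebra.
From mathcomp Require Import all_classical all_reals all_analysis.
From mathcomp Require Import complex.

Set Implicit Arguments.
Unset Strict Implicit.
Unset Printing Implicit Defensive.

Import Order.TTheory GRing.Theory Num.Theory.

Local Open Scope classical_set_scope.
Local Open Scope ring_scope.

Section MetricMahler.
Variable R : realType.

Definition algebraic (z : R[i]) : Prop := algebraicOver (ratr : rat -> R[i]) z.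

Definition root_of_unity (z : R[i]) : Prop := exists n, (0 < n)%N /\ z ^+ n = 1.

(* ln vanishes on nonpositive reals, hence logplus 0 = 0. *)
Definition logplus (t : R) : R := Num.max (ln t) 0.

Definition cabs (z : R[i]) : R := ComplexField.Normc.normc z.

(* The roots of p listed with multiplicity. *)
Definition croots (p : {poly R[i]}) : seq R[i] :=
  sval (closed_field_poly_normal p).

Definition poly_mahler (p : {poly R[i]}) : R :=
  ln (cabs (lead_coef p)) + \sum_(z <- croots p) logplus (cabs z).

(* zcontents carries the sign of the leading coefficient, so the first condition
   says that f is primitive with positive leading coefficient, which singles out
   one of the two minimal polynomials f and - f.  For a primitive f,
   irreducibility in Q[X] is irreducibility in Z[X]. *)
Definition is_int_minpoly (z : R[i]) (f : {poly int}) : Prop :=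
  [/\ zcontents f = 1,
      irreducible_poly (map_poly intr f : {poly rat}) &
      root (map_poly intr f) z].

(* The default value 0 is only reached when z is transcendental. *)
Definition int_minpoly (z : R[i]) : {poly int} := xget 0 (is_int_minpoly z).

Definition mahler (z : R[i]) : R := poly_mahler (map_poly intr (int_minpoly z)).

(* Both big operators have finite support (mahler 1 = 0 and 0 `^ x = 0 for
   0 < x), so they are the infinite product and the infinite sum. *)
Definition metric_mahler (x : R) (a : R[i]) : R :=
  inf [set (\big[+%R/0]_(n \in [set: nat]) (mahler (u n) `^ x)) `^ x^-1
      | u in [set u : nat -> R[i] |
          [/\ forall n, algebraic (u n) /\ u n != 0,
              finite_set [set n | u n != 1] &
              \big[*%R/1]_(n \in [set: nat]) u n = a]]].

Definition mod_mahler (a : R[i]) : R :=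
  inf [set mahler (z * a) | z in [set z | root_of_unity z]].

(* Subfields of R[i] that are Galois over Q; separability is automatic. *)
Definition galois_over_rat (E : {pred R[i]}) : Prop :=
  [/\ divring_closed E,
      {in E, forall z, algebraic z} &
      forall (p : {poly rat}) (y z : R[i]), irreducible_poly p ->
        root (map_poly ratr p) y -> root (map_poly ratr p) z ->
        y \in E -> z \in E].

(* The smallest Galois extension of Q inside R[i] that contains a. *)
Definition galois_closure (a : R[i]) : set R[i] :=
  [set z | forall E : {pred R[i]}, galois_over_rat E -> a \in E -> z \in E].

Definition min_mahler (a : R[i]) : R :=
  inf [set mahler g | g in
        [set g | [/\ galois_closure a g, ~ root_of_unity g & g != 0]]].

End MetricMahler.

(* Main.v *)
(* Fix a number field L, Galois over Q and embedded in the complex numbers, that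
   contains alpha and the factors g_1, ..., g_k of alpha; let K be the normal
   closure of Q(alpha) in L and H = Gal(L/K).  Let N_i, an element of K, be the
   product of the H-orbit of g_i, of size d_i.

   M(N_i) <= M(g_i): the conjugates of N_i are the products of the H-orbits of
   the conjugates of g_i.  So if a is the leading coefficient of the minimal
   polynomial f of g_i, then P = a * prod (X - conjugates of N_i) arises from f
   by multiplying roots together along orbits, some of which are then dropped.
   Hence M(P) <= M(f), and P has integer coefficients because the product of a
   with any set of roots of f is an algebraic integer.

   Taking norms to K gives alpha^#|H| = prod N_i^(#|H| / d_i).
   - If two of the N_i are not torsion, then the sum of the M(g_i)^x is at least
     2 C(alpha)^x, which is at least Mbar(alpha)^x by hypothesis.
   - If only N_i is not torsion, then alpha^d_i = zeta N_i for a root of unity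
     zeta, so some root of unity omega satisfies (omega alpha)^d_i = N_i and
     Mbar(alpha) <= M(omega alpha) <= M(N_i) <= M(g_i), using M(z) <= M(z^d).
   - If all N_i are torsion, then so is alpha, and Mbar(alpha) = 0. *)
Require Import Defs.
From HB Require Import structures.
From mathcomp Require Import all_boot all_order all_algebra.
From mathcomp Require Import all_fingroup all_field.
From mathcomp Require Import all_classical all_reals all_analysis.
From mathcomp Require Import complex ring.

Set Implicit Arguments.
Unset Strict Implicit.
Unset Printing Implicit Defensive.

Import Order.TTheory GRing.Theory Num.Theory.

Local Open Scope ring_scope.

(** * Number fields *)

Lemma map_poly_intr (A B : nzRingType) (f : {rmorphism A -> B})
  (p : {poly int}) : map_poly f (map_poly intr p) = map_poly intr p.
Proof.
by rewrite -map_poly_comp; apply: eq_map_poly => k; rewrite /= rmorph_int.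
Qed.

Lemma map_poly_in_alg (L : fieldExtType rat) (A : unitRingType)
  (f : {rmorphism L -> A}) (p : {poly rat}) :
  map_poly f (map_poly (in_alg L) p) = map_poly ratr p.
Proof.
rewrite -map_poly_comp; apply: eq_map_poly => b.
by rewrite /= alg_num_field fmorph_rat.
Qed.

Section NumberFields.
Variable C : numClosedFieldType.
Local Notation pQtoC := (map_poly (ratr : rat -> C)).

(** Among the non-zero rational polynomials vanishing at z, one of least size is irreducible. *)
Lemma irreducible_root_exists (z : C) :
  algebraicOver (ratr : rat -> C) z ->
  exists p, [/\ root (pQtoC p) z, p != 0 & irreducible_poly p].
Proof.
pose P n := `[< exists p, [/\ p != 0, root (pQtoC p) z & size p = n] >].
move=> [p0 p0_neq0 p0z]; have exP : exists n, P n.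
  by exists (size p0); apply/asboolP; exists p0.
case: (ex_minnP exP) => n /asboolP[p [pn pz <-]] pmin; exists p; split => //.
apply/(subfx_irreducibleP pz pn) => q qz qn; apply: pmin.
by apply/asboolP; exists q.
Qed.

(** Induction on the list by the primitive element theorem. The form of z as a combination of s with
    natural coefficients is kept because it shows later that lifts of s to an abstract number field
    generate it. *)
Lemma primitive_element_seq (s : seq C) :
    {in s, forall z, algebraicOver (ratr : rat -> C) z} ->
  exists z, (exists a : nat -> nat, z = \sum_(i < size s) s`_i *+ a i)
    /\ (exists ps, s = [seq (pQtoC p).[z] | p <- ps]).
Proof.
elim: s => [|x s IHs] algs.
  by exists 0; split; [exists id; rewrite big_ord0 | exists nil].
have [|z [[a Dz] [ps Ds]]] := IHs.
  by move=> y ys; apply: algs; rewrite inE ys orbT.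
have algz : algebraicOver (ratr : rat -> C) z.
  rewrite Dz; elim/big_ind: _ => [|u v|i _]; first exact: algebraic0.
    exact: algebraic_add.
  rewrite -mulr_natl; apply: algebraic_mul.
    by rewrite -(ratr_nat C); apply: algebraic_id.
  by apply: algs; rewrite inE mem_nth ?orbT.
have [rx nz_rx rx0] := algs x (mem_head _ _).
have [rz nz_rz rz0] := algebraic_opp algz.
(* Applied to [- z], the theorem yields the primitive element [x *+ n - (- z)], a sum; the old z is
   the value of [- pz] there. *)
have [n [[pz Dpz] [px Dpx]]] := pchar0_PET nz_rz rz0 nz_rx rx0 (pchar_num _).
rewrite opprK in Dpz Dpx.
exists (x *+ n + z); split.
  exists (fun i => if i is j.+1 then a j else n).
  by rewrite /= big_ord_recl Dz.
exists (px :: [seq p \Po (- pz) | p <- ps]); rewrite /= Dpx; congr (_ :: _).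
rewrite -map_comp [LHS]Ds; apply: eq_map => p /=.
by rewrite map_comp_poly horner_comp rmorphN hornerN Dpz opprK.
Qed.

(** L is Q[X]/(r) for an irreducible polynomial r of a primitive element. That [s1] generates L
    serves to recognise L as a splitting field. *)
Lemma number_field_exists (s : seq C) :
    {in s, forall z, algebraicOver (ratr : rat -> C) z} ->
  exists (L : fieldExtType rat) (iota : {rmorphism L -> C}) (s1 : seq L),
    map iota s1 = s /\ <<1 & s1>>%VS = fullv.
Proof.
move=> algs; have [z [[a Dz] [ps Ds]]] := primitive_element_seq algs.
have algz : algebraicOver (ratr : rat -> C) z.
  rewrite Dz; elim/big_ind: _ => [|u v|i _]; first exact: algebraic0.
    exact: algebraic_add.
  rewrite -mulr_natl; apply: algebraic_mul; last first.
    by apply: algs; rewrite mem_nth.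
  by rewrite -(ratr_nat C); apply: algebraic_id.
have [r [rz0 nz_r irr_r]] := irreducible_root_exists algz.
have [L [iota [z1 z1C z1gen]]] : exists (L : fieldExtType rat)
    (iota : {rmorphism L -> C}), exists2 z1, iota z1 = z
    & forall x, exists p, fieldExt_horner z1 p = x.
  exists (SubFieldExtType rz0 irr_r).
  exists (@subfx_inj _ _ (ratr : {rmorphism rat -> C}) z r).
  exists (subfx_root _ z r) => [|x]; first exact: subfx_inj_root.
  by have [p ->] := subfxEroot rz0 nz_r x; exists p.
pose inL := fieldExt_horner z1; pose s1 := map inL ps.
have inLK p : iota (inL p) = (pQtoC p).[z].
  by rewrite /= -horner_map z1C /= map_poly_in_alg.
exists L, iota, s1; split; first by rewrite -map_comp Ds (eq_map inLK).
have sz_ps : size ps = size s by rewrite Ds size_map.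
apply/vspaceP=> x; rewrite memvf; have [p {x}<-] := z1gen x.
elim/poly_ind: p => [|p b ApL]; first by rewrite rmorph0 mem0v.
rewrite rmorphD rmorphM /= fieldExt_hornerX fieldExt_hornerC -/inL.
suffices -> : z1 = \sum_(i < size s) s1`_i *+ a i.
  rewrite memvD ?memvZ ?mem1v ?memvM ?memv_suml // => i _.
  by rewrite rpredMn ?seqv_sub_adjoin ?mem_nth // size_map sz_ps.
apply: (fmorph_inj iota); rewrite z1C Dz rmorph_sum; apply: eq_bigr => i _.
by rewrite rmorphMn {1}Ds !(nth_map 0) ?sz_ps //= inLK.
Qed.

(** One rational polynomial p vanishes on all of s. The field generated by all complex roots of p is
    a splitting field, and s lies among these roots. *)
Lemma galois_field_exists (s : seq C) :
    {in s, forall z, algebraicOver (ratr : rat -> C) z} ->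
  exists (L : splittingFieldType rat) (iota : {rmorphism L -> C}) (s1 : seq L),
    map iota s1 = s.
Proof.
move=> algs.
have [p [p0 ps]] : exists p : {poly rat},
    p != 0 /\ {in s, forall z, root (pQtoC p) z}.
  elim: s algs => [|x s IHs] algs; first by exists 1; rewrite oner_eq0.
  have [|p [p0 ps]] := IHs.
    by move=> y ys; apply: algs; rewrite inE ys orbT.
  have [q q0 qx] := algs x (mem_head _ _).
  exists (q * p); split; first by rewrite mulf_neq0.
  move=> y; rewrite rmorphM rootM inE => /predU1P[->|/ps->]; rewrite ?orbT //.
  by rewrite qx.
have [rs prs] := closed_field_poly_normal (pQtoC p).
have lp0 : lead_coef (pQtoC p) != 0 by rewrite lead_coef_eq0 map_poly_eq0.
have root_rs x : root (pQtoC p) x = (x \in rs).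
  by rewrite prs rootZ // root_prod_XsubC.
have [z /=|L [iota [rs1 [rs1E genL]]]] := @number_field_exists rs.
  by rewrite -root_rs; exists p.
have pE : map_poly (in_alg L) p
    = (lead_coef p)%:A *: \prod_(x <- rs1) ('X - x%:P).
  apply: (map_inj_poly (fmorph_inj iota) (rmorph0 iota)).
  rewrite [LHS]map_poly_in_alg map_polyZ rmorph_prod [LHS]prs lead_coef_map.
  rewrite alg_num_field fmorph_rat -rs1E big_map; congr (_ *: _).
  by apply: eq_bigr => x _; rewrite rmorphB /= map_polyX map_polyC.
have L_ax : FieldExt_isSplittingField _ L.
  constructor; exists (map_poly (in_alg L) p); last first.
    exists rs1 => //.
    by rewrite pE eqp_scale // scaler_eq0 oner_eq0 orbF lead_coef_eq0.
  by apply/polyOverP => i; rewrite coef_map /= rpredZ ?mem1v.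
have iotaK x : x \in rs -> iota (nth 0 rs1 (index x rs)) = x.
  move=> xrs; rewrite -(nth_map 0 0) ?rs1E ?nth_index //.
  by rewrite -(size_map iota) rs1E index_mem.
exists (HB.pack_for (splittingFieldType rat) L L_ax), iota.
exists [seq nth 0 rs1 (index x rs) | x <- s].
rewrite -map_comp -[RHS]map_id; apply/eq_in_map => x /ps; rewrite root_rs.
exact: iotaK.
Qed.

End NumberFields.

(** * Mahler measures *)

Section MahlerMeasure.
Variable R : realType.
Implicit Types (z w : R[i]) (p q : {poly R[i]}) (s : seq R[i]).

Lemma cabsM z w : cabs (z * w) = cabs z * cabs w.
Proof. exact: ComplexField.Normc.normcM. Qed.

Lemma cabs0 : cabs (0 : R[i]) = 0.
Proof. exact: ComplexField.Normc.normc0. Qed.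

Lemma cabs1 : cabs (1 : R[i]) = 1.
Proof. exact: ComplexField.Normc.normc1. Qed.

Lemma cabs_ge0 z : 0 <= cabs z.
Proof. by case: z => a b; apply: Num.Theory.sqrtr_ge0. Qed.

Lemma cabs_gt0 z : z != 0 -> 0 < cabs z.
Proof.
move=> z0; rewrite lt_neqAle cabs_ge0 andbT eq_sym.
by apply: contra z0 => /eqP/ComplexField.Normc.eq0_normc ->.
Qed.

Lemma cabsX z n : cabs (z ^+ n) = cabs z ^+ n.
Proof. by elim: n => [|n IHn]; rewrite ?cabs1 // !exprS cabsM IHn. Qed.

Lemma cabs_int (n : int) : cabs (n%:~R : R[i]) = `|n%:~R|.
Proof.
by rewrite -(rmorph_int (real_complex R)) /cabs /= expr0n addr0 sqrtr_sqr.
Qed.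

Lemma cabs_int_ge1 (n : int) : n != 0 -> 1 <= cabs (n%:~R : R[i]).
Proof.
move=> n0.
by rewrite cabs_int -intr_norm -[1]/(1%:~R) ler_int -gtz0_ge1 normr_gt0.
Qed.

Lemma logplus_ge0 (t : R) : 0 <= logplus t.
Proof. by rewrite le_max lexx orbT. Qed.

Lemma logplus_le1 (t : R) : t <= 1 -> logplus t = 0.
Proof. by move=> t1; rewrite /logplus max_r // ln_le0. Qed.

Lemma logplusX (t : R) n : 0 <= t -> logplus (t ^+ n) = n%:R * logplus t.
Proof.
rewrite le_eqVlt => /predU1P[<-|t0]; last first.
  by rewrite /logplus lnXn // -(mulr_natl (ln t)) maxr_pMr ?mulr0 ?ler0n.
rewrite !logplus_le1 ?mulr0 //.
by case: n => [|n]; rewrite ?expr0 ?expr0n ?ler01.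
Qed.

Lemma logplusM (t u : R) : 0 <= t -> 0 <= u ->
  logplus (t * u) <= logplus t + logplus u.
Proof.
rewrite le_eqVlt => /predU1P[<- _|t0].
  by rewrite mul0r logplus_le1 // addr_ge0 ?logplus_ge0.
rewrite le_eqVlt => /predU1P[<-|u0].
  by rewrite mulr0 logplus_le1 // addr_ge0 ?logplus_ge0.
rewrite ge_max addr_ge0 ?logplus_ge0 // andbT lnM //.
by rewrite lerD // le_max lexx.
Qed.

Lemma logplus_prod s :
  logplus (cabs (\prod_(z <- s) z)) <= \sum_(z <- s) logplus (cabs z).
Proof.
elim: s => [|z s IHs]; first by rewrite !big_nil cabs1 logplus_le1.
rewrite !big_cons cabsM (le_trans (logplusM _ _)) ?cabs_ge0 //.
by rewrite lerD2l.
Qed.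

(** [croots] is some chosen list of roots; uniqueness of the factorization makes it a permutation of
    s. *)
Lemma poly_mahler_prod (a : R[i]) s : a != 0 ->
  poly_mahler (a *: \prod_(z <- s) ('X - z%:P))
  = ln (cabs a) + \sum_(z <- s) logplus (cabs z).
Proof.
move=> a0; set p := _ *: _.
have lp : lead_coef p = a.
  by rewrite lead_coefZ (monicP (monic_prod_XsubC _ _ _)) mulr1.
rewrite /poly_mahler lp; congr (_ + _); apply: perm_big.
apply: prod_XsubC_eq; apply: (scalerI a0).
by rewrite -[a in LHS]lp /croots; case: closed_field_poly_normal.
Qed.

Lemma poly_mahlerE p : exists2 s, p = lead_coef p *: \prod_(z <- s) ('X - z%:P)
  & poly_mahler p = ln (cabs (lead_coef p)) + \sum_(z <- s) logplus (cabs z).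
Proof.
by exists (croots p) => //; rewrite /croots; case: closed_field_poly_normal.
Qed.

Lemma poly_mahlerM p q : p != 0 -> q != 0 ->
  poly_mahler (p * q) = poly_mahler p + poly_mahler q.
Proof.
have [s ps ->] := poly_mahlerE p; have [t qt ->] := poly_mahlerE q.
rewrite -!lead_coef_eq0 => p0 q0; rewrite [in LHS]ps [in LHS]qt.
rewrite -scalerAl -scalerAr scalerA -big_cat poly_mahler_prod ?mulf_neq0 //=.
by rewrite cabsM lnM ?posrE ?cabs_gt0 // big_cat addrACA.
Qed.

Lemma poly_mahler_int_ge0 (f : {poly int}) :
  0 <= poly_mahler (map_poly intr f : {poly R[i]}).
Proof.
apply: addr_ge0; last by apply: sumr_ge0 => z _; apply: logplus_ge0.
rewrite lead_coef_map_inj //; last exact: intr_inj.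
(* The zero polynomial is covered by the convention [ln 0 = 0]. *)
have [->|f0] := eqVneq f 0; first by rewrite lead_coef0 cabs0 ln0.
by rewrite ln_ge0 // cabs_int_ge1 // lead_coef_eq0.
Qed.

(** Each of the n roots z satisfies |z|^n = |w| and contributes one n-th of the right-hand side. *)
Lemma poly_mahler_XnsubC n w : (0 < n)%N ->
  poly_mahler ('X^n - w%:P) = logplus (cabs w).
Proof.
move=> n0; have szp := size_XnsubC w n0.
have lp : lead_coef ('X^n - w%:P) = 1 :> R[i].
  rewrite lead_coefDl ?lead_coefXn // size_polyXn size_polyN size_polyC.
  by case: eqP.
have [s ps ->] := poly_mahlerE ('X^n - w%:P).
rewrite lp scale1r in ps *; rewrite cabs1 ln1 add0r.
have sz : size s = n by move: szp; rewrite ps size_prod_XsubC => -[].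
have -> : \sum_(z <- s) logplus (cabs z) =
          \sum_(z <- s) n%:R^-1 * logplus (cabs w).
  rewrite big_seq [RHS]big_seq; apply: eq_bigr => z zs.
  have /rootP : root ('X^n - w%:P) z by rewrite ps root_prod_XsubC.
  rewrite !hornerE => /eqP; rewrite subr_eq0 => /eqP <-.
  by rewrite cabsX logplusX ?cabs_ge0 // mulKf // pnatr_eq0 -lt0n.
rewrite big_const_seq count_predT sz iter_addr_0 -(mulr_natl (_ * _)).
by rewrite mulVKf // pnatr_eq0 -lt0n.
Qed.

(** A linear factor X - z becomes X^n - z, which has the same Mahler measure. *)
Lemma poly_mahler_comp_Xn p n : p != 0 -> (0 < n)%N ->
  poly_mahler (p \Po 'X^n) = poly_mahler p.
Proof.
move=> p0 n0; have [s ps ->] := poly_mahlerE p; rewrite [in LHS]ps.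
have a0 : lead_coef p != 0 by rewrite lead_coef_eq0.
move: (lead_coef p) a0 {ps} => a a0; rewrite comp_polyZ rmorph_prod /=.
(* Non-vanishing joins the induction because multiplicativity is stated for non-zero factors. *)
suff [] : a *: \prod_(z <- s) (('X - z%:P) \Po 'X^n) != 0 /\
  poly_mahler (a *: \prod_(z <- s) (('X - z%:P) \Po 'X^n)) =
  ln (cabs a) + \sum_(z <- s) logplus (cabs z) by [].
elim: s => [|z s [IH0 IH]].
  rewrite !big_nil scaler_eq0 oner_eq0 orbF a0; split=> //.
  rewrite -[1](big_nil 1 *%R xpredT (fun z => 'X - z%:P)).
  by rewrite poly_mahler_prod // big_nil.
rewrite !big_cons scalerAr rmorphB /= comp_polyX comp_polyC.
have z0 : 'X^n - z%:P != 0 :> {poly R[i]} by rewrite -size_poly_eq0 size_XnsubC.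
by rewrite mulf_neq0 // poly_mahlerM // IH poly_mahler_XnsubC // addrCA.
Qed.

(** Clearing denominators in an irreducible rational polynomial and passing to the primitive part
    changes it only by a non-zero rational factor. *)
Lemma algebraic_int_minpoly z : algebraic z -> is_int_minpoly z (int_minpoly z).
Proof.
move=> /irreducible_root_exists[p [pz pn irr_p]].
suff : exists f, is_int_minpoly z f by rewrite /int_minpoly; apply: xgetPex.
have [q [a an pE]] := rat_poly_scale p.
have qn : q != 0 by apply: contraNneq pn => q0; rewrite pE q0 rmorph0 scaler0.
have mapE : map_poly intr q
    = (zcontents q)%:~R *: map_poly intr (zprimitive q) :> {poly rat}.
  by rewrite [q in LHS]zpolyEprim map_polyZ.
have {}pE : p = ((zcontents q)%:~R / a%:~R) *: map_poly intr (zprimitive q).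
  by rewrite mulrC -scalerA -mapE.
have c0 : (zcontents q)%:~R / a%:~R != 0 :> rat.
  by rewrite mulf_neq0 ?invr_eq0 ?intr_eq0 ?zcontents_eq0.
exists (zprimitive q); split; first by rewrite zcontents_primitive qn.
- case: irr_p => p1 irr; split; first by rewrite -(size_scale _ c0) -pE.
  move=> r r1 rd; have : r %= p by apply: irr; rewrite // pE dvdpZr.
  by move/eqp_trans; apply; rewrite pE eqp_scale.
- move: pz; rewrite pE map_polyZ /= rootZ ?fmorph_eq0 //.
  by rewrite map_poly_intr.
Qed.

(** The gcd over Q vanishes at z, so it is not constant and is associated to the irreducible f.
    Since f is primitive, divisibility descends to Z by the lemma of Gauss. *)
Lemma int_minpoly_dvd z (f p : {poly int}) : is_int_minpoly z f ->
  root (map_poly intr p) z -> exists r, p = f * r.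
Proof.
move=> [f1 irr fz] pz.
have /dvdpP_int[r ->] : f %| p; last first.
  by exists r; rewrite {2}[f]zpolyEprim f1 scale1r.
rewrite -dvdp_rat_int.
pose g : {poly rat} := gcdp (map_poly intr f) (map_poly intr p).
have gz : root (map_poly ratr g) z.
  by rewrite gcdp_map root_gcd !map_poly_intr fz.
have gd : g %| map_poly intr f by apply: dvdp_gcdl.
case: irr => _ irr.
have [g1|/irr/(_ gd)] := eqVneq (size g) 1; last first.
  by rewrite /eqp => /andP[_ /dvdp_trans]; apply; apply: dvdp_gcdr.
move: gz; have /eqP/size_poly1P[c c0 ->] := g1.
by rewrite map_polyC rootC /= fmorph_eq0 (negPf c0).
Qed.

Lemma int_minpoly_neq0 z : algebraic z -> int_minpoly z != 0.
Proof.
case/algebraic_int_minpoly => + _ _.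
by apply: contra_eq_neq => ->; rewrite zcontents0.
Qed.

Lemma mahler_ge0 z : 0 <= mahler z.
Proof. exact: poly_mahler_int_ge0. Qed.

(** The cofactor of the minimal polynomial in p has integer coefficients, hence non-negative Mahler
    measure. *)
Lemma mahler_le z (p : {poly int}) : p != 0 -> root (map_poly intr p) z ->
  mahler z <= poly_mahler (map_poly intr p : {poly R[i]}).
Proof.
move=> p0 pz; have algz : algebraic z.
  exists (map_poly intr p).
    by rewrite map_poly_eq0_id0 // intr_eq0 lead_coef_eq0.
  by rewrite map_poly_intr.
have [r pr] := int_minpoly_dvd (algebraic_int_minpoly algz) pz.
rewrite pr mulf_eq0 negb_or in p0; case/andP: p0 => f0 r0.
have inj : injective (intr : int -> R[i]) by exact: intr_inj.
rewrite pr rmorphM /= poly_mahlerM ?map_poly_eq0_id0 ?intr_eq0 //;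
  rewrite ?lead_coef_eq0 //.
by rewrite lerDl poly_mahler_int_ge0.
Qed.

(** If f is the minimal polynomial of z^n, then z is a root of f(X^n), which has the same measure as
    f. *)
Lemma mahler_le_exp z n : (0 < n)%N -> algebraic z ->
  mahler z <= mahler (z ^+ n).
Proof.
move=> n0 algz.
have algzn : algebraic (z ^+ n).
  elim: n {n0} => [|n IHn]; first exact: algebraic1.
  by rewrite exprS; apply: algebraic_mul.
have [_ _ fz] := algebraic_int_minpoly algzn; have := int_minpoly_neq0 algzn.
rewrite /(mahler (z ^+ n)); move: (int_minpoly _) fz => f fz f0.
have mf0 : map_poly intr f != 0 :> {poly R[i]}.
  by rewrite map_poly_eq0_id0 // intr_eq0 lead_coef_eq0.
have cE : map_poly intr (f \Po 'X^n) = map_poly intr f \Po 'X^n :> {poly R[i]}.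
  by rewrite map_comp_poly map_polyXn.
rewrite -(poly_mahler_comp_Xn mf0 n0) -cE; apply: mahler_le.
  by rewrite comp_poly_eq0 // size_polyXn.
by rewrite cE root_comp hornerXn.
Qed.

Lemma mahler_root_of_unity z : Defs.root_of_unity z -> mahler z = 0.
Proof.
move=> [n [n0 zn]].
have p0 : 'X^n - 1 != 0 :> {poly int} by rewrite -size_poly_eq0 size_XnsubC.
have pE : map_poly intr ('X^n - 1 : {poly int}) = 'X^n - 1%:P :> {poly R[i]}.
  by rewrite rmorphB /= map_polyXn rmorph1.
have pz : root (map_poly intr ('X^n - 1 : {poly int})) z.
  by rewrite pE rootE !hornerE zn subrr.
apply/eqP; rewrite eq_le mahler_ge0 andbT (le_trans (mahler_le p0 pz)) //.
by rewrite pE poly_mahler_XnsubC // logplus_le1 // cabs1.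
Qed.

End MahlerMeasure.

(** * Algebraic integers attached to an integer polynomial *)

Section IntegralCoefficients.
Variables (A K : comNzRingType) (f : {rmorphism A -> K}).
Implicit Types (u v : {poly K}) (x : K).
Local Notation integral_coefs u := (forall i, integralOver f u`_i).

Lemma integral_coefsZ x u :
  integralOver f x -> integral_coefs u -> integral_coefs (x *: u).
Proof. by move=> ix iu i; rewrite coefZ; apply: mxpoly.integral_mul. Qed.

Lemma integral_coefsMXn n u : integral_coefs u -> integral_coefs (u * 'X^n).
Proof.
by move=> iu i; rewrite coefMXn; case: ifP => // _; apply: mxpoly.integral0.
Qed.

Lemma integral_coefsB u v :
  integral_coefs u -> integral_coefs v -> integral_coefs (u - v).
Proof. by move=> iu iv i; rewrite coefB; apply: mxpoly.integral_sub. Qed.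

(* c x is a root of c^(n - 1) v(X / c), which is monic. *)
Lemma integral_lead_coefM v x : root v x -> integral_coefs v ->
  integralOver f (lead_coef v * x).
Proof.
move=> /rootP vx0 iv; set c := lead_coef v.
have [v0|vn0] := eqVneq v 0.
  by rewrite /c v0 lead_coef0 mul0r; apply: mxpoly.integral0.
case szv : (size v) => [|[|m]].
- by move/eqP: szv; rewrite size_poly_eq0 (negPf vn0).
- move: vx0 vn0; have := size1_polyC (eq_leq szv).
  by move=> ->; rewrite hornerC => ->; rewrite eqxx.
have vE : v.[x] = \sum_(i < m.+1) v`_i * x ^+ i + c * x ^+ m.+1.
  by rewrite horner_coef szv big_ord_recr /= /c lead_coefE szv.
pose q0 := \poly_(i < m.+1) (v`_i * c ^+ (m - i)); pose q := 'X^(m.+1) + q0.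
have q0_lt : (size q0 < size ('X^(m.+1) : {poly K})%R)%N.
  by rewrite size_polyXn ltnS size_poly.
apply: (@integral_root_monic _ _ _ _ q).
- by rewrite monicE lead_coefDl // lead_coefXn.
- apply/rootP; rewrite hornerD hornerXn horner_poly.
  transitivity (c ^+ m * v.[x]); last by rewrite vx0 mulr0.
  rewrite vE mulrDr addrC mulr_sumr; congr +%R.
    apply: eq_bigr => i _; rewrite exprMn -mulrA [c ^+ (m - i) * _]mulrA -exprD.
    have im : (i <= m)%N by rewrite -ltnS.
    by rewrite subnK // mulrCA.
  by rewrite exprMn mulrA -exprSr.
- apply/integral_poly => i; rewrite coefD coefXn coef_poly.
  apply: mxpoly.integral_add; first exact: mxpoly.integral_nat.
  case: ifP => _; last exact: mxpoly.integral0.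
  apply: mxpoly.integral_mul; first exact: iv.
  elim: (m - i)%N => [|k IHk]; first exact: integral1.
  by rewrite exprS; apply: mxpoly.integral_mul => //; apply: iv.
Qed.

(* If v = u (X - x) has leading coefficient c and n = deg u, then u - c X^n
   times X - x is v - c X^(n+1) + c x X^n, and c x is integral. *)
Lemma integral_coefs_factor u x :
  integral_coefs (u * ('X - x%:P)) -> integral_coefs u.
Proof.
move: {2}(size u) (leqnn (size u)) => n; elim: n u => [|n IHn] u.
  rewrite size_poly_leq0 => /eqP-> _ i; rewrite coef0.
  exact: mxpoly.integral0.
rewrite leq_eqVlt ltnS => /predU1P[szu|/IHn//] iux.
have un0 : u != 0 by rewrite -size_poly_eq0 szu.
have iu_lead : integralOver f (lead_coef u).
  by rewrite -(lead_coef_Mmonic u (monicXsubC x)); apply: iux.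
have ilx : integralOver f (lead_coef u * x).
  rewrite -(lead_coef_Mmonic u (monicXsubC x)).
  apply: integral_lead_coefM => //; apply/rootP.
  by rewrite hornerM hornerXsubC subrr mulr0.
have uE : u = take_poly n u + lead_coef u *: 'X^n.
  apply/polyP => i; rewrite coefD coef_take_poly coefZ coefXn lead_coefE szu /=.
  have [->|] := eqVneq i n; first by rewrite ltnn add0r mulr1.
  rewrite mulr0 addr0 ltn_neqAle => -> /=; case: leqP => // ni.
  by rewrite nth_default // szu.
have it : integral_coefs (take_poly n u).
  apply: IHn; first exact: size_take_poly.
  have -> : take_poly n u * ('X - x%:P) = u * ('X - x%:P)
      - (lead_coef u *: (1 * 'X^(n.+1)) - (lead_coef u * x) *: (1 * 'X^n)).
    have eqE (t : {poly K}) c : t * ('X - x%:P) = (t + c *: 'X^n) * ('X - x%:P)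
        - (c *: (1 * 'X^(n.+1)) - (c * x) *: (1 * 'X^n)).
      by rewrite -!mul_polyC rmorphM /= exprS; ring.
    by rewrite [LHS](eqE _ (lead_coef u)) -uE.
  have i1 : integral_coefs (1 : {poly K}).
    by move=> i; rewrite coef1; apply: mxpoly.integral_nat.
  apply: integral_coefsB => //; apply: integral_coefsB;
    by apply: integral_coefsZ => //; apply: integral_coefsMXn.
move=> i; rewrite uE coefD coefZ coefXn; apply: mxpoly.integral_add => //.
by apply: mxpoly.integral_mul => //; apply: mxpoly.integral_nat.
Qed.

(** By the identity x u = X u - u (X - x). *)
Lemma integral_coefs_scale_root u x :
  integral_coefs (u * ('X - x%:P)) -> integral_coefs (x *: u).
Proof.
move=> iux; have iu := integral_coefs_factor iux.
have -> : x *: u = u * 'X^1 - u * ('X - x%:P).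
  by rewrite expr1 mulrBr opprB addrC subrK mulrC mul_polyC.
by apply: integral_coefsB => //; apply: integral_coefsMXn.
Qed.

(** For constant u the second part is the classical fact that the leading coefficient times a
    product of some roots is integral. *)
Lemma integral_coefs_drop_roots (s : seq K) u :
  integral_coefs (u * \prod_(x <- s) ('X - x%:P)) ->
  integral_coefs u /\ integral_coefs ((\prod_(x <- s) x) *: u).
Proof.
elim: s u => [|x s IHs] u; first by rewrite !big_nil mulr1 scale1r.
rewrite !big_cons mulrA => /IHs[iu iv]; split.
  exact: integral_coefs_factor iu.
by rewrite -scalerA; apply: integral_coefs_scale_root; rewrite -scalerAl.
Qed.

(** If v is the remaining factor and P the product of s, then v (X - P) = X v - P v, and both v and
    P v are integral once the roots in s are dropped. *)
Lemma integral_coefs_merge_roots (ss : seq (seq K)) u :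
  integral_coefs (u * \prod_(s <- ss) \prod_(x <- s) ('X - x%:P)) ->
  integral_coefs (u * \prod_(s <- ss) ('X - (\prod_(x <- s) x)%:P)).
Proof.
elim: ss u => [|s ss IHss] u; first by rewrite !big_nil.
rewrite !big_cons mulrA => /IHss; rewrite mulrAC.
case/integral_coefs_drop_roots => iu iv.
rewrite mulrCA mulrBl mul_polyC; apply: integral_coefsB => //.
by rewrite mulrC -['X]expr1; apply: integral_coefsMXn.
Qed.

End IntegralCoefficients.

(** By the lemma of Gauss, X - r is a rational multiple of an integer polynomial q dividing a monic
    one, so q has leading coefficient 1 or -1. *)
Lemma integral_rat_int (r : rat) :
  integralOver (intr : int -> rat) r -> exists n : int, r = n%:~R.
Proof.
move=> [p /monicP p1].
rewrite -dvdp_XsubCl => /dvdpP_rat_int[q [a a0 qE] [t pE]].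
have qt1 : lead_coef q * lead_coef t = 1 by rewrite -lead_coefM -pE.
have lE : a * (lead_coef q)%:~R = 1.
  rewrite -[RHS](lead_coefXsubC r) qE lead_coefZ lead_coef_map_inj //.
  exact: intr_inj.
have rE : r = - (a * (q`_0)%:~R).
  have := congr1 (fun g : {poly rat} => g`_0) qE.
  by rewrite coefB coefX coefC /= sub0r coefZ coef_map /= => <-; rewrite opprK.
have [a1|a1] : a = 1 \/ a = -1.
  have /eqP : absz (lead_coef q * lead_coef t) = 1 by rewrite qt1.
  rewrite abszM muln_eq1 => /andP[lq1 _]; move: lE lq1.
  case: (lead_coef q) => [[|[|n]]|[|n]] //= lE _.
    by left; rewrite mulr1 in lE.
  by right; apply: oppr_inj; rewrite opprK -lE mulrN mulr1.
  by exists (- q`_0); rewrite rE a1 mul1r rmorphN.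
by exists (q`_0); rewrite rE a1 mulN1r opprK.
Qed.

(** * Products of Galois orbits *)

Section GaloisOrbits.
Variables (L : splittingFieldType rat) (K : {subfield L}).
Hypothesis nK : normalField 1 K.
Local Notation gT := (gal_of {:L}).
Local Notation H := 'Gal({:L} / K)%g.
Implicit Types (sigma tau : gT) (A : {set gT}) (x y : L).

(** Duplicates are removed so that the orbit under the full group lists the roots of the minimal
    polynomial, each once. *)
Definition gal_orbit A x : seq L :=
  undup [seq (sigma : gT) x | sigma <- enum A].

Definition orbit_prod A x : L := \prod_(y <- gal_orbit A x) y.

Lemma galMf sigma tau x : (sigma * tau)%g x = tau (sigma x).
Proof. by apply: galM; apply: memvf. Qed.

Lemma gal_orbitP A x y :
  reflect (exists2 sigma, sigma \in A & y = sigma x) (y \in gal_orbit A x).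
Proof.
rewrite mem_undup; apply: (iffP mapP) => -[sigma].
  by rewrite mem_enum; exists sigma.
by move=> sA ->; exists sigma; rewrite ?mem_enum.
Qed.

Lemma gal_orbit_uniq A x : uniq (gal_orbit A x).
Proof. exact: undup_uniq. Qed.

Lemma gal_orbit_gal (A : {group gT}) sigma x : sigma \in A ->
  perm_eq (gal_orbit A (sigma x)) (gal_orbit A x).
Proof.
move=> sA; apply: uniq_perm; rewrite ?gal_orbit_uniq // => y.
apply/gal_orbitP/gal_orbitP => -[tau tA ->].
  by exists (sigma * tau)%g; rewrite ?groupM ?galMf.
by exists (sigma^-1 * tau)%g; rewrite ?groupM ?groupV // -galMf mulKVg.
Qed.

(** Products act from left to right, so tau (sigma x) = (sigma ^ tau) (tau x). *)
Lemma map_gal_orbit A tau x : tau \in 'N(A)%g ->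
  perm_eq [seq tau y | y <- gal_orbit A x] (gal_orbit A (tau x)).
Proof.
move=> nA; apply: uniq_perm; rewrite ?gal_orbit_uniq //.
  by rewrite map_inj_uniq ?gal_orbit_uniq //; apply: fmorph_inj.
move=> y; apply/mapP/gal_orbitP.
- move=> [_ /gal_orbitP[sigma sA ->] ->].
  exists (sigma ^ tau)%g; first by rewrite memJ_norm.
  by rewrite -!galMf conjgE !mulgA mulgV mul1g.
- move=> [sigma sA ->]; exists ((sigma ^ tau^-1)%g x); last first.
    by rewrite -!galMf conjgE invgK !mulgA mulgKV.
  by apply/gal_orbitP; exists (sigma ^ tau^-1)%g; rewrite ?memJ_norm ?groupV.
Qed.

Lemma orbit_prod_norm A tau x : tau \in 'N(A)%g ->
  tau (orbit_prod A x) = orbit_prod A (tau x).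
Proof.
move=> nA; rewrite /orbit_prod rmorph_prod -(perm_big _ (map_gal_orbit x nA)).
by rewrite big_map.
Qed.

Lemma orbit_prod_gal (A : {group gT}) sigma x : sigma \in A ->
  orbit_prod A (sigma x) = orbit_prod A x.
Proof. by move=> sA; apply: perm_big; apply: gal_orbit_gal. Qed.

(** The elements of A that carry x to tau x form the right coset by tau of the stabilizer. *)
Lemma count_gal_orbit (A : {group gT}) x y : y \in gal_orbit A x ->
  count_mem y [seq (sigma : gT) x | sigma <- enum A]
  = #|[set sigma in A | sigma x == x]|.
Proof.
move=> /gal_orbitP[tau tA ->]; set S := [set _ in _ | _].
rewrite count_map -(card_rcoset S tau) cardE -size_filter.
apply/perm_size/uniq_perm => [||sigma]; first exact: filter_uniq (enum_uniq _).
  exact: enum_uniq.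
rewrite mem_filter /= !mem_enum mem_rcoset inE groupMr ?groupV // andbC.
congr (_ && _).
by rewrite -[RHS](inj_eq (fmorph_inj tau)) /= -galMf mulgKV.
Qed.

(** Orbit and stabilizer: e is the order of the stabilizer of x, d the length of the orbit. *)
Lemma prod_gal_orbit (A : {group gT}) x : exists e d, [/\ (0 < e)%N, (0 < d)%N,
  #|A| = (d * e)%N & \prod_(sigma in A) sigma x = orbit_prod A x ^+ e].
Proof.
pose S := [set sigma in A | sigma x == x]; exists #|S|, (size (gal_orbit A x)).
split.
- by apply/card_gt0P; exists 1%g; rewrite inE group1 gal_id eqxx.
- have : x \in gal_orbit A x by apply/gal_orbitP; exists 1%g; rewrite ?gal_id.
  by case: gal_orbit.
- rewrite cardE -(size_map (fun sigma : gT => sigma x)) -sum1_size.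
  rewrite -big_undup_iterop_count /= -sum1_size big_distrl /=.
  apply: eq_big_seq => y /count_gal_orbit ->.
  by rewrite Monoid.iteropE iter_addn_0 mulnC.
rewrite /orbit_prod -prodrXl -big_enum.
rewrite -(big_map (fun sigma : gT => sigma x) xpredT id).
rewrite -big_undup_iterop_count; by apply: eq_big_seq => y /count_gal_orbit ->.
Qed.

Lemma galois1 : galois 1 {:L}.
Proof.
rewrite /galois sub1v normalFieldf andbT; apply/separableP => x _.
apply: pcharf0_separable => p; apply/negbTE/negP => /andP[p_pr].
rewrite -(rmorph_nat (in_alg L)) fmorph_eq0 pnatr_eq0 => /eqP p0.
by rewrite p0 in p_pr.
Qed.

Lemma mem_gal1 sigma : sigma \in 'Gal({:L} / 1)%g.
Proof. by rewrite gal_kHom ?sub1v // k1AHom. Qed.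

Lemma minPoly_gal_orbit x :
  minPoly 1 x = \prod_(y <- gal_orbit 'Gal({:L} / 1)%g x) ('X - y%:P).
Proof.
have /(galois_factors (sub1v _))/(_ x (memvf x)) [r [rG r_uniq mE]] := galois1.
rewrite mE; apply/perm_big/uniq_perm; rewrite ?gal_orbit_uniq // => y.
rewrite -root_prod_XsubC -mE; apply/idP/gal_orbitP => [|[sigma _ ->]].
  rewrite mE root_prod_XsubC => /mapP[sigma _ ->].
  by exists sigma; rewrite ?mem_gal1.
by apply: root_minPoly_gal; rewrite ?sub1v ?memvf ?mem_gal1.
Qed.

(** Conjugation by sigma turns Gal(L/K) into Gal(L/sigma(K)), and sigma(K) = K by normality. *)
Lemma normal_gal_norm sigma : sigma \in 'N(H)%g.
Proof.
apply/normP; rewrite gal_conjg; congr ('Gal(_ / _))%g.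
move/forall_inP: nK => /(_ (sigma : 'AEnd(L))) /(_ _)/eqP; apply.
by rewrite inE kAutfE k1AHom.
Qed.

(** The product is fixed by H, and K is the fixed field of H. *)
Lemma orbit_prod_in x : orbit_prod H x \in K.
Proof.
have /galois_fixedField fixK : galois K {:L}.
  by apply: galoisS galois1; rewrite sub1v subvf.
suff : orbit_prod H x \in fixedField H by rewrite fixK.
apply/fixedFieldP => [|sigma sH]; first exact: memvf.
by rewrite orbit_prod_norm ?normal_gal_norm // orbit_prod_gal.
Qed.

(** Orbits that meet coincide and then have the same product. *)
Lemma flatten_gal_orbit_uniq (A : {group gT}) (t : seq L) :
  uniq [seq orbit_prod A y | y <- t] ->
  uniq (flatten [seq gal_orbit A y | y <- t]).
Proof.
elim: t => //= y t IHt /andP[yt /IHt ut].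
rewrite cat_uniq gal_orbit_uniq ut andbT /=; apply: contra yt.
move=> /hasP[z /flatten_mapP[y' y't /gal_orbitP[s sA ->]] /gal_orbitP[s' s'A]].
move/(congr1 (orbit_prod A)); rewrite !orbit_prod_gal // => <-.
exact: map_f.
Qed.

(** The list t picks one conjugate of x above each conjugate of N, and [rest] collects the
    conjugates outside their H-orbits. These orbits are disjoint because their products differ. *)
Lemma orbit_prod_conjugates x :
  let G := 'Gal({:L} / 1)%g in exists t rest,
     gal_orbit G (orbit_prod H x) = [seq orbit_prod H y | y <- t]
  /\ perm_eq (flatten [seq gal_orbit H y | y <- t] ++ rest) (gal_orbit G x).
Proof.
move=> G; set N := orbit_prod H x.
(* If sigma N = b, then the H-orbit of sigma x has product b, since sigma normalizes H. *)
pose c b := (odflt 1%g [pick sigma : gT | sigma N == b]) x.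
have cE b : b \in gal_orbit G N -> orbit_prod H (c b) = b.
  move=> /gal_orbitP[sigma _ ->]; rewrite /c.
  case: pickP => /= [tau /eqP <-|/(_ sigma)].
    by rewrite [RHS]orbit_prod_norm ?normal_gal_norm.
  by rewrite eqxx.
pose t := [seq c b | b <- gal_orbit G N].
have tE : gal_orbit G N = [seq orbit_prod H y | y <- t].
  by rewrite -map_comp -[LHS]map_id; apply/eq_in_map => b /cE.
pose ft := flatten [seq gal_orbit H y | y <- t].
exists t, [seq y <- gal_orbit G x | y \notin ft]; split=> //.
apply: uniq_perm; rewrite ?gal_orbit_uniq //.
  rewrite cat_uniq flatten_gal_orbit_uniq -?tE ?gal_orbit_uniq //=.
  rewrite filter_uniq ?gal_orbit_uniq // andbT -all_predC.
  by apply/allP => y; rewrite mem_filter => /andP[].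
move=> y; rewrite mem_cat mem_filter.
have [/flatten_mapP[z /mapP[b _ ->]]|//] := boolP (y \in ft).
move=> /gal_orbitP[s sH ->]; apply/esym/gal_orbitP.
by eexists; [exact: mem_gal1 | rewrite -galMf].
Qed.

End GaloisOrbits.

(** * Mahler measure of an orbit product *)

Section MahlerOrbitProd.
Variables (R : realType) (L : splittingFieldType rat) (K : {subfield L}).
Variable iota : {rmorphism L -> R[i]}.
Hypothesis nK : normalField 1 K.
Implicit Types x y : L.

Lemma algebraic_number_field x : algebraic (iota x).
Proof.
have /polyOver1P[m mE] := minPolyOver 1 x.
exists m.
  by rewrite -(map_poly_eq0 (in_alg L)) -mE monic_neq0 ?monic_minPoly.
by have := rmorph_root iota (root_minPoly 1 x); rewrite mE map_poly_in_alg.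
Qed.

Lemma int_minpoly_number_field x (f : {poly int}) : is_int_minpoly (iota x) f ->
  map_poly intr f = (lead_coef f)%:~R *: minPoly 1 x.
Proof.
move=> [_ irr fx].
have toL := map_poly_intr (in_alg L).
have /polyOver1P[m mE] := minPolyOver 1 x.
have mdvd : m %| map_poly intr f.
  rewrite -(dvdp_map (in_alg L)) -mE toL; apply: minPoly_dvdp.
    by rewrite -toL; apply/polyOver1P; exists (map_poly intr f).
  by rewrite -(fmorph_root iota) map_poly_intr.
have m1 : lead_coef m = 1.
  apply: (fmorph_inj (in_alg L)); rewrite -lead_coef_map -mE rmorph1.
  exact/eqP/monic_minPoly.
have sm : size m != 1%N.
  by rewrite -(size_map_poly (in_alg L)) -mE size_minPoly eqSS -lt0n.
have /eqp_eq := irr.2 _ sm mdvd.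
rewrite m1 scale1r lead_coef_map_inj //; last exact: intr_inj.
by move=> fE; rewrite -toL -fE mE map_polyZ rmorph_int.
Qed.

Lemma mahler_orbit_prod x :
  mahler (iota (orbit_prod 'Gal({:L} / K)%g x)) <= mahler (iota x).
Proof.
set H := 'Gal({:L} / K)%g; set N := orbit_prod H x; set G := 'Gal({:L} / 1)%g.
have fP := algebraic_int_minpoly (algebraic_number_field x).
rewrite /(mahler (iota x)); move: (int_minpoly _) fP => f fP.
have fE := int_minpoly_number_field fP; set a := lead_coef f in fE.
have a0 : a != 0.
  rewrite lead_coef_eq0; case: fP => + _ _.
  by apply: contra_eq_neq => ->; rewrite zcontents0.
have [t [rest [tE perm_t]]] := orbit_prod_conjugates nK x.
rewrite -/G -/H -/N in tE perm_t.
have mapC := map_poly_intr iota.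
have mapP (s : seq L) : map_poly iota (a%:~R *: \prod_(y <- s) ('X - y%:P))
     = a%:~R *: \prod_(z <- map iota s) ('X - z%:P).
  rewrite map_polyZ rmorph_int rmorph_prod big_map; congr (_ *: _).
  by apply: eq_bigr => y _; rewrite rmorphB /= map_polyX map_polyC.
(* Dropping the roots in [rest] from f and merging the others along their orbits keeps the
   coefficients integral over Z. *)
have [g gE] : exists g : {poly int}, map_poly intr g = a%:~R *: minPoly 1 N.
  have : forall i, integralOver (intr : int -> L) (a%:~R *: minPoly 1 N)`_i.
    rewrite minPoly_gal_orbit tE big_map -mul_polyC.
    pose ss := [seq gal_orbit H y | y <- t].
    have := @integral_coefs_merge_roots _ _ intr ss a%:~R%:P.
    rewrite !big_map; apply.
    set v := _ * _.
    suff : forall i, integralOver (intr : int -> L)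
        (v * \prod_(z <- rest) ('X - z%:P))`_i.
      by case/integral_coefs_drop_roots.
    have -> : v * \prod_(z <- rest) ('X - z%:P) = map_poly intr f :> {poly L}.
      rewrite fE minPoly_gal_orbit -(perm_big _ perm_t) big_cat big_flatten.
      by rewrite big_map /= -mulrA mul_polyC.
    by move=> i; rewrite coef_map; apply: mxpoly.integral_id.
  (* The coefficients are also rational, hence integers. *)
  have /polyOver1P[p pE] : a%:~R *: minPoly 1 N \is a polyOver 1%VS.
    by rewrite polyOverZ ?minPolyOver // rpred_int.
  rewrite pE => int_p; exists (map_poly numq p); rewrite -map_poly_comp.
  apply/polyP => i; rewrite coef_map_id0 // coef_map /=.
  have [|n ->] := @integral_rat_int p`_i; last first.
    by rewrite numq_int -in_algE rmorph_int.
  have [q q_monic q0] := int_p i; exists q => //.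
  by rewrite -(fmorph_root (in_alg L)) map_poly_intr; rewrite coef_map in q0.
have N_monic := monic_minPoly 1 N.
have g0 : g != 0.
  apply: contra_eq_neq gE => ->; rewrite rmorph0 eq_sym scaler_eq0.
  rewrite -(rmorph_int (in_alg L)) fmorph_eq0 intr_eq0 (negPf a0).
  exact: monic_neq0.
have gN : root (map_poly intr g) (iota N).
  rewrite -mapC gE map_polyZ rootZ ?rmorph_int ?intr_eq0 //.
  by rewrite rmorph_root ?root_minPoly.
apply: le_trans (mahler_le g0 gN) _.
(* Both polynomials have leading coefficient a. The dropped roots contribute non-negative terms, and
   merging is controlled by the subadditivity of [logplus] on products. *)
rewrite -!mapC gE fE !minPoly_gal_orbit !mapP !poly_mahler_prod ?intr_eq0 //.
rewrite lerD2l -/G tE !big_map -(perm_big _ perm_t) big_cat /=.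
rewrite -[leLHS]addr0 lerD ?sumr_ge0 // => [|y _]; last exact: logplus_ge0.
rewrite big_flatten big_map; apply: ler_sum => y _.
rewrite /orbit_prod rmorph_prod -(big_map iota xpredT id).
by rewrite (le_trans (logplus_prod _)) // big_map.
Qed.

End MahlerOrbitProd.

(** * Roots of unity *)

Section RootsOfUnity.
Variable R : realType.
Implicit Types z w : R[i].

Lemma root_of_unity1 : Defs.root_of_unity (1 : R[i]).
Proof. by exists 1; rewrite expr1n. Qed.

Lemma root_of_unityM z w :
  Defs.root_of_unity z -> Defs.root_of_unity w -> Defs.root_of_unity (z * w).
Proof.
move=> [m [m0 zm]] [n [n0 wn]]; exists (m * n)%N; rewrite muln_gt0 m0 n0.
split=> //.
by rewrite exprMn exprM zm expr1n mulnC exprM wn expr1n mulr1.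
Qed.

Lemma root_of_unityV z : Defs.root_of_unity z -> Defs.root_of_unity z^-1.
Proof. by move=> [n [n0 zn]]; exists n; rewrite exprVn zn invr1. Qed.

Lemma root_of_unityX z n : Defs.root_of_unity z -> Defs.root_of_unity (z ^+ n).
Proof.
move=> z1; elim: n => [|n IHn]; first exact: root_of_unity1.
by rewrite exprS; apply: root_of_unityM.
Qed.

Lemma root_of_unity_expP z n : (0 < n)%N ->
  Defs.root_of_unity (z ^+ n) -> Defs.root_of_unity z.
Proof.
by move=> n0 [m [m0 zmn]]; exists (n * m)%N; rewrite muln_gt0 n0 m0 exprM.
Qed.

Lemma root_of_unity_prod (s : seq R[i]) :
  {in s, forall z, Defs.root_of_unity z} ->
  Defs.root_of_unity (\prod_(z <- s) z).
Proof.
move=> s1; rewrite big_seq; elim/big_ind: _ => //; first exact: root_of_unity1.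
exact: root_of_unityM.
Qed.

Lemma root_of_unity_algebraic z : Defs.root_of_unity z -> algebraic z.
Proof.
move=> [n [n0 zn]]; exists ('X^n - 1).
  by rewrite -size_poly_eq0 size_XnsubC.
by rewrite rmorphB /= map_polyXn rmorph1 rootE !hornerE zn subrr.
Qed.

Lemma root_of_unity_neq0 z : Defs.root_of_unity z -> z != 0.
Proof.
move=> [n [n0 zn]]; apply: contra_eq_neq zn => ->.
by rewrite expr0n eqn0Ngt n0 eq_sym oner_eq0.
Qed.

End RootsOfUnity.

(** * Normal closures inside a number field *)

Section NormalClosure.
Variables (R : realType) (L : splittingFieldType rat).
Variable iota : {rmorphism L -> R[i]}.

Lemma adjoin_seq_divring (E : divringClosed R[i]) (s : seq L) :
    {in s, forall y, iota y \in E} ->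
  forall y, y \in <<1 & s>>%VS -> iota y \in E.
Proof.
move=> sE; suff sub (F : {subfield L}) : (forall z, z \in F -> iota z \in E) ->
    forall y, y \in <<F & s>>%VS -> iota y \in E.
  apply: (sub 1%AS) => z /vlineP[k ->].
  by rewrite alg_num_field fmorph_rat rpred_div ?rpred_int.
elim: s sE F => [|x s IHs] sE F FE z; first by rewrite Fadjoin_nil; apply: FE.
rewrite adjoin_cons; apply: (IHs _ <<F; x>>%AS) => [w ws|w].
  by apply: sE; rewrite inE ws orbT.
move=> /Fadjoin_polyP[p /polyOverP pF ->].
rewrite horner_coef rmorph_sum rpred_sum // => i _.
by rewrite rmorphM rmorphXn rpredM ?FE ?rpredX // sE ?mem_head.
Qed.

(** K is generated by the conjugates of a, and every Galois subfield of the complex numbers that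
    contains a contains them. *)
Lemma normal_closure_exists (a : L) : exists K : {subfield L},
  [/\ normalField 1 K, a \in K
    & forall y, y \in K -> galois_closure (iota a) (iota y)].
Proof.
have [r /eqP mE] := splitting_field_normal 1 a.
have rr y : root (minPoly 1 a) y = (y \in r) by rewrite mE root_prod_XsubC.
exists <<1 & r>>%AS; split.
- apply/splitting_normalField; first exact: sub1v.
  exists (minPoly 1 a); first exact: minPolyOver.
  by exists r; rewrite // mE eqpxx.
- by apply: seqv_sub_adjoin; rewrite -rr root_minPoly.
move=> y yK E [Ering Ealg Egal] aE.
have /polyOver1P[m mE'] := minPolyOver 1 a.
have mroot z : root (map_poly ratr m) (iota z) = (z \in r).
  by rewrite -rr mE' -(fmorph_root iota) map_poly_in_alg.
have irr_m : irreducible_poly m.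
  split; first by rewrite -(size_map_poly (in_alg L)) -mE' size_minPoly ltnS.
  move=> q q1 qm; have qO : map_poly (in_alg L) q \is a polyOver 1%VS.
    by apply/polyOver1P; exists q.
  have := @minPoly_irr _ _ 1%AS a _ qO; rewrite mE' dvdp_map eqp_map => /(_ qm).
  case/orP=> // /eqp_size; rewrite size_map_poly size_poly1 => q1'.
  by rewrite q1' in q1.
have rE z : z \in r -> iota z \in E.
  rewrite -mroot => mz; apply: (Egal m (iota a)) => //.
  by rewrite mroot -rr root_minPoly.
pose E_closed : divringClosed R[i] :=
  HB.pack_for (divringClosed R[i]) E (GRing.isDivringClosed.Build _ E Ering).
exact: (@adjoin_seq_divring E_closed r).
Qed.

End NormalClosure.

(** * Lower bounds for factorizations *)

Section MainInequality.
Variable R : realType.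
Implicit Types (z w alpha : R[i]) (s : seq R[i]).

Lemma mod_mahler_ge0 alpha : 0 <= mod_mahler alpha.
Proof.
apply: lb_le_inf.
  by exists (mahler (1 * alpha)), 1 => //; apply: root_of_unity1.
by move=> _ [z _ <-]; apply: mahler_ge0.
Qed.

Lemma mod_mahler_le alpha z : Defs.root_of_unity z ->
  mod_mahler alpha <= mahler (z * alpha).
Proof.
move=> z1; apply: ge_inf; last by exists z.
by exists 0 => _ [w _ <-]; apply: mahler_ge0.
Qed.

Lemma min_mahler_le alpha z :
  galois_closure alpha z -> ~ Defs.root_of_unity z -> z != 0 ->
  min_mahler alpha <= mahler z.
Proof.
move=> zK z1 z0; apply: ge_inf; last by exists z.
by exists 0 => _ [w _ <-]; apply: mahler_ge0.
Qed.

Lemma min_mahler_ge0 alpha : 0 <= min_mahler alpha.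
Proof.
rewrite /min_mahler; set S := (X in inf X).
(* The infimum of the empty set is 0 by convention. *)
have [->|/set0P S0] := eqVneq S set0; first by rewrite inf0.
by apply: lb_le_inf => // _ [w _ <-]; apply: mahler_ge0.
Qed.

(** With alpha^d = zeta w, a d-th root z of 1/zeta is a root of unity and (z alpha)^d = w. *)
Lemma mod_mahler_le_root alpha w d : (0 < d)%N -> algebraic alpha -> w != 0 ->
  Defs.root_of_unity (alpha ^+ d / w) -> mod_mahler alpha <= mahler w.
Proof.
move=> d0 alg_a w0 tors; set zeta := _ / w in tors.
have zd := rootCK d0 zeta^-1; set z := d.-root _ in zd.
have z1 : Defs.root_of_unity z.
  by apply: (root_of_unity_expP d0); rewrite zd; apply: root_of_unityV.
have -> : w = (z * alpha) ^+ d.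
  rewrite exprMn zd /zeta invfM invrK mulrAC mulVf ?mul1r //.
  have := root_of_unity_neq0 tors; rewrite mulf_eq0 negb_or; case/andP=> //.
apply: le_trans (mod_mahler_le _ z1) (mahler_le_exp d0 _).
by apply: algebraic_mul => //; apply: root_of_unity_algebraic.
Qed.

(** The cases count the factors with non-torsion orbit product: none, one, at least two. Since
    [rem z s] removes one occurrence only, z and w stand at different positions but may be equal. *)
Lemma mahler_factorization alpha s :
  algebraic alpha -> alpha != 0 -> {in s, forall z, algebraic z} ->
  \prod_(z <- s) z = alpha ->
  [\/ mod_mahler alpha = 0,
      exists2 z, z \in s & mod_mahler alpha <= mahler z
    | exists z w, [/\ z \in s, w \in rem z s, min_mahler alpha <= mahler z
        & min_mahler alpha <= mahler w]].
Proof.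
move=> alg_a a0 alg_s prod_s.
have [|L [iota [[//|a s1]] [/esym aE /esym sE]]] :=
    @galois_field_exists _ (alpha :: s).
  by move=> z; rewrite inE => /predU1P[->|/alg_s].
have {}prod_s : \prod_(y <- s1) y = a.
  by apply: (fmorph_inj iota); rewrite rmorph_prod -aE -prod_s sE big_map.
have an0 : a != 0 by apply: contraNneq a0 => a0; rewrite aE a0 rmorph0.
have s1n0 y : y \in s1 -> y != 0.
  apply: contraTneq => ->; apply: contra an0 => s10.
  by rewrite -prod_s prodf_seq_eq0; apply/hasP; exists 0; rewrite ?eqxx.
have [K [nK aK Kcl]] := normal_closure_exists iota a.
set H := 'Gal({:L} / K)%g.
pose N y := orbit_prod H y.
have N0 y : y != 0 -> N y != 0.
  move=> y0; rewrite prodf_seq_neq0; apply/allP => _ /gal_orbitP[sigma _ ->].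
  by rewrite fmorph_eq0.
pose T y := `[< Defs.root_of_unity (iota (N y)) >].
have gnorm y : exists e d, [/\ (0 < e)%N, (0 < d)%N, #|H| = (d * e)%N &
    galNorm K {:L} y = N y ^+ e] by exact: prod_gal_orbit.
have gnorm_a : galNorm K {:L} a = a ^+ #|H|.
  rewrite /galNorm -prodr_const; apply: eq_bigr => sigma sH.
  by rewrite (fixed_gal _ sH) // subvf.
have torsT (t : seq L) : all T t ->
    Defs.root_of_unity (iota (galNorm K {:L} (\prod_(y <- t) y))).
  move=> /allP tT; rewrite galNorm_prod rmorph_prod /=.
  rewrite -(big_map (fun y => iota (galNorm K {:L} y)) xpredT id).
  apply: root_of_unity_prod => _ /mapP[y /tT/asboolP Ty ->].
  have [e [d [_ _ _ ->]]] := gnorm y.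
  by rewrite rmorphXn; apply: root_of_unityX.
have minN y : y \in s1 -> ~~ T y -> min_mahler alpha <= mahler (iota y).
  move=> ys yT; apply: le_trans (mahler_orbit_prod iota nK y).
  apply: min_mahler_le; first by rewrite aE; apply/Kcl/orbit_prod_in.
    by move=> NT; case/negP: yT; apply/asboolP.
  by rewrite fmorph_eq0 N0 ?s1n0.
(* If all orbit products are torsion, so is the norm a^#|H|, and hence alpha. *)
have [allT|/allPn[y ys yT]] := boolP (all T s1).
  constructor 1.
  have := torsT _ allT; rewrite prod_s gnorm_a rmorphXn -aE.
  move=> /(root_of_unity_expP (cardG_gt0 _)) tors_a.
  apply/eqP; rewrite eq_le mod_mahler_ge0 andbT.
  apply: le_trans (mod_mahler_le alpha (root_of_unityV tors_a)) _.
  by rewrite mulVf // mahler_root_of_unity //; apply: root_of_unity1.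
have remE (z : L) : rem (iota z) s = map iota (rem z s1).
  rewrite sE; elim: s1 {s1n0 prod_s sE minN ys} => //= w t ->.
  by rewrite (inj_eq (fmorph_inj iota)); case: eqP.
have [allT|/allPn[y' ys' yT']] := boolP (all T (rem y s1)); last first.
  constructor 3; exists (iota y), (iota y'); split; rewrite ?minN //.
  - by rewrite sE map_f.
  - by rewrite remE map_f.
  - exact: mem_rem ys'.
constructor 2; exists (iota y); first by rewrite sE map_f.
apply: le_trans (mahler_orbit_prod iota nK y).
have [e [d [e0 d0 cardH Ne]]] := gnorm y.
apply: (@mod_mahler_le_root _ _ d) => //; first by rewrite fmorph_eq0 N0 ?s1n0.
apply: (@root_of_unity_expP _ _ e) => //.
(* The other factors have product a / y with torsion norm; this norm is (a^d / N y)^e because #|H| =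
   d e. *)
have := torsT _ allT; congr (Defs.root_of_unity _).
have -> : \prod_(z <- rem y s1) z = a / y.
  by rewrite -prod_s [X in X / _](big_rem y) //= mulrAC divff ?mul1r ?s1n0.
rewrite galNormM galNormV gnorm_a Ne fmorph_div !rmorphXn -aE.
by rewrite cardH exprM -exprVn -exprMn.
Qed.

End MainInequality.

(** * Comparison of the metric and the modified Mahler measure *)

Section MetricMahler.
Variable R : realType.
Implicit Types (x : R) (alpha : R[i]).

Lemma fsbigT_seq (T : Type) (idx : T) (op : Monoid.com_law idx) (I : choiceType)
    (r : seq I) (F : I -> T) : uniq r -> (forall i, i \notin r -> F i = idx) ->
  \big[op/idx]_(i \in [set: I]%classic) F i = \big[op/idx]_(i <- r) F i.
Proof.
move=> r_uniq F1; rewrite (@fsbigE _ _ _ _ _ r) //; last first.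
  by move=> i _; apply: F1.
by apply: eq_bigl => i; rewrite in_setT.
Qed.

Lemma powRK x (t : R) : x != 0 -> 0 <= t -> (t `^ x) `^ x^-1 = t.
Proof. by move=> x0 t0; rewrite -powRrM mulfV // powRr1. Qed.

(* For c = 0 the left-hand side of the hypothesis is +oo, hence there is no need
   to know that C(alpha) > 0. *)
Lemma powR_le_double x (m c : R) : 0 < x -> 0 < m -> 0 <= c ->
  (x%:E * (lne m%:E - lne c%:E) <= (ln 2)%:E)%E ->
  m `^ x <= 2 * c `^ x.
Proof.
move=> x0 m0; rewrite le_eqVlt => /predU1P[<-|c0].
  by rewrite lne_EFin // le0_lneNy //= gt0_muley // leye_eq.
rewrite !lne_EFin // -EFinB -EFinM lee_fin => h.
rewrite /powR (gt_eqF m0) (gt_eqF c0) -[2]lnK ?posrE // -expRD ler_expR.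
by rewrite -lerBlDr -mulrBr.
Qed.

Lemma mod_mahler_le_sum x alpha (s : seq R[i]) : 0 < x ->
  algebraic alpha -> alpha != 0 -> {in s, forall z, algebraic z} ->
  \prod_(z <- s) z = alpha ->
  (x%:E * (lne (mod_mahler alpha)%:E - lne (min_mahler alpha)%:E)
     <= (ln 2)%:E)%E ->
  mod_mahler alpha `^ x <= \sum_(z <- s) mahler z `^ x.
Proof.
move=> x0 alg_a a0 alg_s prod_s hcond.
have sum_ge0 (t : seq R[i]) : 0 <= \sum_(z <- t) mahler z `^ x.
  by apply: sumr_ge0 => z _; apply: powR_ge0.
have powR_mono (t u : R) : 0 <= t -> t <= u -> t `^ x <= u `^ x.
  move=> t0 tu.
  by apply: (ge0_ler_powR (ltW x0)); rewrite ?nnegrE // (le_trans t0).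
have [m0|m_neq0] := eqVneq (mod_mahler alpha) 0.
  by rewrite m0 powR0 ?gt_eqF.
case: (mahler_factorization alg_a a0 alg_s prod_s)
  => [m0|[z zs mz]|[z [w [zs ws cz cw]]]].
- by rewrite m0 eqxx in m_neq0.
- rewrite (big_rem z) //= -[leLHS]addr0 lerD //.
  by apply: powR_mono => //; apply: mod_mahler_ge0.
- have m_gt0 : 0 < mod_mahler alpha.
    by rewrite lt_neqAle eq_sym m_neq0 mod_mahler_ge0.
  apply: le_trans (powR_le_double x0 m_gt0 (min_mahler_ge0 _) hcond) _.
  rewrite (big_rem z) //= (big_rem w) //= addrA -[leLHS]addr0 lerD //.
  by rewrite mulr_natl mulr2n lerD // powR_mono // min_mahler_ge0.
Qed.

(** In the factorization of alpha as z alpha times 1/z, the second factor has measure 0. *)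
Lemma metric_mahler_le x alpha z : 0 < x -> algebraic alpha -> alpha != 0 ->
  Defs.root_of_unity z -> metric_mahler x alpha <= mahler (z * alpha).
Proof.
move=> x0 alg_a a0 z1; apply: ge_inf.
  by exists 0 => _ [u _ <-]; apply: powR_ge0.
pose u n := if n is 0 then z * alpha else if n is 1 then z^-1 else 1 : R[i].
have u1 n : n \notin [:: 0; 1]%N -> u n = 1 by case: n => [|[|n]].
exists u; last first.
  rewrite (@fsbigT_seq _ _ _ _ [:: 0; 1]%N) => [|//|n /u1 ->]; last first.
    by rewrite mahler_root_of_unity ?powR0 ?gt_eqF //; apply: root_of_unity1.
  rewrite !big_cons big_nil /= (mahler_root_of_unity (root_of_unityV z1)).
  by rewrite powR0 ?gt_eqF // !addr0 powRK ?gt_eqF // mahler_ge0.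
have z0 := root_of_unity_neq0 z1; have alg_z := root_of_unity_algebraic z1.
split.
- case=> [|[|n]] /=; split.
  + exact: algebraic_mul.
  + by rewrite mulf_neq0.
  + exact: algebraic_inv.
  + by rewrite invr_eq0.
  + exact: algebraic1.
  + by rewrite oner_eq0.
- apply: (@sub_finite_set _ _ [set` [:: 0; 1]%N]); last exact: finite_seq.
  by move=> n /= un; apply: contraNT un => /u1 ->.
- rewrite (@fsbigT_seq _ _ _ _ [:: 0; 1]%N) // !big_cons big_nil /= mulr1.
  by rewrite mulrAC mulfV // mul1r.
Qed.

End MetricMahler.

Theorem theorem1p2 (R : realType) (alpha : R[i]) (x : R)
  (halg : algebraic alpha) (hneq0 : alpha != 0) (hx : 0 < x)
  (hcond : (x%:E * (lne (mod_mahler alpha)%:E - lne (min_mahler alpha)%:E)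
              <= (ln 2)%:E)%E) :
  metric_mahler x alpha = mod_mahler alpha.
Proof.
apply/eqP; rewrite eq_le; apply/andP; split.
  apply: lb_le_inf.
    by exists (mahler (1 * alpha)); exists 1 => //; apply: root_of_unity1.
  by move=> _ [z z1 <-]; apply: metric_mahler_le.
apply: lb_le_inf.
  (* The trivial factorization shows that the infimum is taken over a non-empty set. *)
  pose u n := if n is 0 then alpha else 1 : R[i].
  have u1 n : n \notin [:: 0]%N -> u n = 1 by case: n.
  eexists; exists u => //; split.
  - by case=> [|n]; split; rewrite /= ?oner_eq0 //; apply: algebraic1.
  - apply: (@sub_finite_set _ _ [set` [:: 0]%N]); last exact: finite_seq.
    by move=> n /= un; apply: contraNT un => /u1 ->.
  - by rewrite (@fsbigT_seq _ _ _ _ [:: 0]%N) // big_seq1.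
move=> _ [u [u_alg u_fin u_prod] <-].
(* Outside r the factors are 1 and have measure 0, so both infinite operators reduce to r. *)
pose r := finmap.enum_fset (fset_set [set n | u n != 1]%classic).
have r_uniq : uniq r by apply: finmap.fset_uniq.
have u1 n : n \notin r -> u n = 1.
  rewrite in_fset_set // => /negP; rewrite inE /= => un.
  by apply/eqP/negPn/negP.
rewrite (fsbigT_seq _ r_uniq) // => [|n /u1 ->]; last first.
  by rewrite mahler_root_of_unity ?powR0 ?gt_eqF //; apply: root_of_unity1.
rewrite (fsbigT_seq _ r_uniq) // in u_prod.
(* The left side becomes the x-th root of its x-th power, so it suffices to compare the x-th
   powers. *)
rewrite -[leLHS](@powRK _ x) ?gt_eqF ?mod_mahler_ge0 //.
apply: ge0_ler_powR; rewrite ?invr_ge0 ?(ltW hx) // ?nnegrE ?powR_ge0 //.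
  by apply: sumr_ge0 => n _; apply: powR_ge0.
rewrite -(big_map u xpredT (fun z => mahler z `^ x)).
apply: mod_mahler_le_sum => //; last by rewrite big_map.
by move=> _ /mapP[n _ ->]; have [] := u_alg n.
Qed.
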